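(* Let $N,d\ge 1$ and let $f_1,\dots,f_N:\mathbb R^d\to\mathbb R$ be convex functions such that $L_i:=\sup_{z\in\mathbb R^d}\sup_{g\in\partial f_i(z)}\|g\|_1<\infty$ for each $i$, and such that $f:=\sum_{i=1}^N f_i$ has at least one minimizer on $\mathbb R^d$. Let $A(t)=(a_{ij}(t))$, $t\ge0$, be $N\times N$ column-stochastic matrices with no zero rows satisfying $$a^+:=\inf_{t\ge0}\Big[\min_{i,j:\,a_{ij}(t)>0}a_{ij}(t)\Big]>0$$ and, for some $T\in\mathbb N$, $$A(t+T-1)\cdots A(t+1)A(t)>0\qquad\text{for all }t\ge0.$$ Let $\alpha\in[-1,-1/2)$, $c>0$, and let $\theta(t)=ct^\alpha$ for $t\ge1$, with $\theta(0)\ge0$ arbitrary. Let $y_i(t)\in\mathbb R$ and $w_i(t)\in\mathbb R^d$ satisfy, for $1\le i\le N$ and $t\ge0$, $$y_i(t+1)=\sum_{j=1}^N a_{ij}(t)y_j(t),$$ $$w_i(t+1)=\sum_{j=1}^N a_{ij}(t)w_j(t)-\theta(t)g_i(t),\qquad g_i(t)\in\partial f_i\Big(\frac{w_i(t)}{y_i(t)}\Big),$$ with $y_i(0)>0$ for all $i$ and $w_i(0)\in\mathbb R^d$ arbitrary. Then there exists a minimizer $x^*$ of $f$ such that $\lim_{t\to\infty}\frac{w_i(t)}{y_i(t)}=x^*$ for all $1\le i\le N$.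
   Context: A nonnegative square matrix is column-stochastic if each of its columns sums to $1$. For a matrix $A$, $A>0$ means every entry is positive. $\partial f_i(z)$ is the (convex) subdifferential of $f_i$ at $z$, and $\|g\|_1=\sum_l|g_l|$. *)

(* Defs.v *)
From HB Require Import structures.
From mathcomp Require Export all_boot all_order all_algebra.
From mathcomp Require Export all_classical all_reals all_analysis.

Set Implicit Arguments.
Unset Strict Implicit.
Unset Printing Implicit Defensive.

Import Order.TTheory GRing.Theory Num.Theory.
Export numFieldNormedType.Exports.

Local Open Scope classical_set_scope.
Local Open Scope ring_scope.

Section vectors.
Context {R : realType} {d : nat}.
Implicit Types (f : 'rV[R]_d -> R) (g z : 'rV[R]_d).

Definition dotv (u v : 'rV[R]_d) : R := \sum_(l < d) u ord0 l * v ord0 l.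

Definition norm1 g : R := \sum_(l < d) `|g ord0 l|.

Definition subdifferential f z : set 'rV[R]_d :=
  [set g | forall x, f z + dotv g (x - z) <= f x].

Definition subgrad_bound f : \bar R :=
  ereal_sup [set ereal_sup [set (norm1 g)%:E | g in subdifferential f z]
            | z in [set: 'rV[R]_d]].

Definition minimizer f x : Prop := forall z, f x <= f z.

End vectors.

Section matrices.
Context {R : realType} {N : nat}.
Implicit Types (M : 'M[R]_N) (A : nat -> 'M[R]_N).

Definition column_stochastic M : Prop :=
  (forall i j, 0 <= M i j) /\ (forall j, \sum_(i < N) M i j = 1).

Definition no_zero_row M : Prop := forall i, row i M != 0.

Definition positive_mx M : Prop := forall i j, 0 < M i j.

(* The unit +oo of the minimum is the value on a matrix without positive
   entries; a column-stochastic matrix of size N >= 1 always has one. *)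
Definition min_positive_entry M : \bar R :=
  \big[Order.min/+oo%E]_(ij : 'I_N * 'I_N | 0 < M ij.1 ij.2)
    (M ij.1 ij.2)%:E.

Definition inf_positive_entry A : \bar R :=
  ereal_inf [set min_positive_entry (A t) | t in [set: nat]].

(* A (t + k - 1) *m ... *m A (t + 1) *m A t, with later factors on the left *)
Fixpoint backward_product A (t k : nat) : 'M[R]_N :=
  if k is k'.+1 then A (t + k')%N *m backward_product A t k' else 1%:M.

End matrices.

(* Main.v *)
(* In the ratios z_i = w_i / y_i the recursion is a perturbed row-stochastic
   averaging. Over T steps all averaging weights are bounded below, so the
   diameter D of {z_1, ..., z_N} satisfies D(t+T) <= (1 - eta) D(t) + S(t), with
   S a window sum of step sizes; hence sum D^2 and sum theta D are finite, because
   sum theta^2 is. The mean u = sum_i w_i / sum_i y_i stays within D of every z_i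
   and performs a perturbed subgradient step on f, so |u - x|^2 is quasi-Fejer
   monotone for each minimizer x and sum theta (f(u) - min f) is finite. Since
   sum theta diverges, some cluster point of u is a minimizer, and the Fejer
   property upgrades it to the limit. The Lipschitz bound on f_i needs subgradients
   at arbitrary points, which a finite-dimensional Hahn-Banach argument gives. *)
Require Import Defs.
From mathcomp Require Import all_boot all_order all_algebra.
From mathcomp Require Import all_classical all_reals all_analysis.
From mathcomp Require Import ring lra.

Set Implicit Arguments.
Unset Strict Implicit.
Unset Printing Implicit Defensive.

Import Order.TTheory GRing.Theory Num.Theory.
Import numFieldNormedType.Exports.

Local Open Scope classical_set_scope.
Local Open Scope ring_scope.

(** * The Euclidean pairing, the sup norm and the 1-norm *)

Section dot_product.
Context {R : realType} {d : nat}.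
Implicit Types (u v g : 'rV[R]_d) (a : R).

Lemma dotvDl u v g : dotv (u + v) g = dotv u g + dotv v g.
Proof. by rewrite -big_split; apply: eq_bigr => l _; rewrite mxE mulrDl. Qed.

Lemma dotvC u v : dotv u v = dotv v u.
Proof. by apply: eq_bigr => l _; rewrite mulrC. Qed.

Lemma dotvDr u v g : dotv g (u + v) = dotv g u + dotv g v.
Proof. by rewrite dotvC dotvDl !(dotvC g). Qed.

Lemma dotvZl a u v : dotv (a *: u) v = a * dotv u v.
Proof. by rewrite mulr_sumr; apply: eq_bigr => l _; rewrite mxE mulrA. Qed.

Lemma dotvZr a u v : dotv u (a *: v) = a * dotv u v.
Proof. by rewrite dotvC dotvZl dotvC. Qed.

Lemma dotvNr u v : dotv u (- v) = - dotv u v.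
Proof. by rewrite -scaleN1r dotvZr mulN1r. Qed.

Lemma dotvBr u v g : dotv g (u - v) = dotv g u - dotv g v.
Proof. by rewrite dotvDr dotvNr. Qed.

Lemma dotv_suml (I : Type) (r : seq I) (F : I -> 'rV[R]_d) v :
  dotv (\sum_(i <- r) F i) v = \sum_(i <- r) dotv (F i) v.
Proof.
elim: r => [|i r IH]; last by rewrite !big_cons dotvDl IH.
by rewrite !big_nil; apply: big1 => l _; rewrite mxE mul0r.
Qed.

Lemma dotv_delta (k : 'I_d) v : dotv (delta_mx ord0 k) v = v ord0 k.
Proof.
rewrite /dotv (bigD1 k)//= big1 => [|l /negPf lk]; rewrite mxE eqxx.
  by rewrite eqxx mul1r addr0.
by rewrite lk mul0r.
Qed.

Lemma dotv_ge0 v : 0 <= dotv v v.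
Proof. by apply: sumr_ge0 => l _; rewrite -expr2 sqr_ge0. Qed.

Lemma coord_le_norm v (l : 'I_d) : `|v ord0 l| <= `|v|.
Proof.
rewrite [leRHS]/Num.norm /= mx_normrE.
exact: (le_bigmax _ (fun x : 'I_1 * 'I_d => `|v x.1 x.2|) (ord0, l)).
Qed.

Lemma norm_le v a : 0 <= a -> (forall l, `|v ord0 l| <= a) -> `|v| <= a.
Proof.
move=> a0 va; rewrite [leLHS]/Num.norm /= mx_normrE.
by apply: bigmax_le => // -[i l] _; rewrite /= ord1.
Qed.

(** Hölder duality: the norm of a row vector is the sup norm, dual to [norm1]. *)
Lemma dotv_le g v : `|dotv g v| <= norm1 g * `|v|.
Proof.
apply: le_trans (ler_norm_sum _ _ _) _.
rewrite mulr_suml; apply: ler_sum => l _.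
by rewrite normrM ler_wpM2l// coord_le_norm.
Qed.

Lemma norm1_ge0 g : 0 <= norm1 g.
Proof. exact: sumr_ge0. Qed.

Lemma norm_le_norm1 g : `|g| <= norm1 g.
Proof.
apply: norm_le (norm1_ge0 g) _ => l.
by rewrite /norm1 (bigD1 l)//= lerDl sumr_ge0.
Qed.

(** The Fejer argument lives on [dotv v v], while limits are taken in the sup norm; this bound and
    [dotv_le_norm_sqr] pass between the two. *)
Lemma norm_sqr_le_dotv v : `|v| ^+ 2 <= dotv v v.
Proof.
rewrite -(sqr_sqrtr (dotv_ge0 v)) lerXn2r ?nnegrE ?sqrtr_ge0//.
apply: norm_le (sqrtr_ge0 _) _ => l; rewrite -sqrtr_sqr ler_wsqrtr//.
rewrite /dotv (bigD1 l)//= -expr2 lerDl sumr_ge0// => k _.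
by rewrite -expr2 sqr_ge0.
Qed.

Lemma dotv_le_norm_sqr v : dotv v v <= d%:R * `|v| ^+ 2.
Proof.
rewrite -[d in d%:R]card_ord mulr_natl -sumr_const; apply: ler_sum => l _.
by rewrite -expr2 -real_normK ?num_real// lerXn2r ?nnegrE ?coord_le_norm.
Qed.

End dot_product.

(** * Existence of subgradients and the Lipschitz bound *)

Section subgradients.
Context {R : realType} {d : nat}.
Implicit Types (f : 'rV[R]_d -> R) (u v x z g : 'rV[R]_d).

(** Homogeneous form of convexity: the weights need not sum to 1, so the extension step below can
    choose them to cancel a coordinate. *)
Lemma convex_function_pos f : convex_function [set: 'rV[R]_d] f ->
  forall (p q : R) u v, 0 < p -> 0 < q ->
  (p + q) * f ((p + q)^-1 *: (p *: u + q *: v)) <= p * f u + q * f v.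
Proof.
move=> cf p q u v p0 q0.
have pq0 : 0 < p + q by lra.
(* [convex_function] quantifies over coefficients bundled with their membership in the unit
   interval. *)
have t01 : Itv.spec (@Itv.num_sem R) (Itv.Real `[0%Z, 1%Z]) (p / (p + q)).
  rewrite /Itv.num_sem /= num_real /= in_itv /=.
  rewrite mulr0z mulr1z divr_ge0 ?(ltW p0) ?(ltW pq0)//=.
  by rewrite ler_pdivrMr// mul1r lerDl ltW.
have /= := cf (Itv.mk t01) u v (in_setT _) (in_setT _).
rewrite /conv /= /unstable.onem => h.
have e1 : (p + q)^-1 *: (p *: u + q *: v) =
          (p / (p + q)) *: u + (1 - p / (p + q)) *: v.
  rewrite scalerDr !scalerA; congr (_ *: _ + _ *: _); field; lra.
rewrite e1; rewrite -(ler_pM2l pq0) in h; apply: le_trans h _.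
rewrite le_eqVlt; apply/predU1P; left.
rewrite [X in _ * X = _](_ : _ =
    p / (p + q) * f u + (1 - p / (p + q)) * f v); last exact: convRE.
field; lra.
Qed.

(* Hahn-Banach extension, one coordinate direction per induction step. *)
Lemma subgradient_partial f z (k : nat) :
  convex_function [set: 'rV[R]_d] f -> (k <= d)%N ->
  exists g, forall v, (forall l : 'I_d, (k <= l)%N -> v ord0 l = 0) ->
    f z + dotv g v <= f (z + v).
Proof.
move=> cf; elim: k => [_|k IH kd].
  exists 0 => v v0; have -> : v = 0.
    by apply/rowP => l; rewrite mxE v0.
  by rewrite addr0 -(scale0r 0) dotvZl mul0r addr0.
have [g hg] := IH (ltnW kd); pose K := Ordinal kd.
(* Excess of [f] over the affine minorant built so far: convex, and nonnegative on vectors supported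
   on the first [k] coordinates. *)
pose G v := f (z + v) - f z - dotv g v.
have cG p q u v : 0 < p -> 0 < q ->
    (p + q) * G ((p + q)^-1 *: (p *: u + q *: v)) <= p * G u + q * G v.
  move=> p0 q0; have := convex_function_pos cf (z + u) (z + v) p0 q0.
  have -> : (p + q)^-1 *: (p *: (z + u) + q *: (z + v)) =
            z + (p + q)^-1 *: (p *: u + q *: v).
    rewrite [p *: (_ + _)]scalerDr [q *: (_ + _)]scalerDr addrACA -scalerDl.
    rewrite scalerDr scalerA mulVf ?scale1r//.
    by rewrite gt_eqF// addr_gt0.
  move=> h; rewrite /G dotvZr dotvDr !dotvZr !mulrBr [_ * (_^-1 * _)]mulrA.
  rewrite divff ?mul1r; last by rewrite gt_eqF// addr_gt0.
  lra.
pose supp v := forall l : 'I_d, (k.+1 <= l)%N -> v ord0 l = 0.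
(* With weights [- r] and [s], coordinate [K] of the combination cancels, so [hg] applies to it;
   hence slopes on the negative side stay below slopes on the positive side. *)
have key u v : supp u -> supp v -> 0 < u ord0 K -> v ord0 K < 0 ->
    G v / v ord0 K <= G u / u ord0 K.
  move=> su sv u0 v0; set s := u ord0 K in u0 *; set r := v ord0 K in v0 *.
  have r0 : 0 < - r by lra.
  have sr : 0 < - r + s by lra.
  have := cG _ _ u v r0 u0; set m := _^-1 *: _ => h.
  have Gm : 0 <= G m.
    rewrite /G -addrA -opprD subr_ge0; apply: hg => l.
    rewrite leq_eqVlt => /predU1P[kl|kl].
      have -> : l = K by apply: val_inj.
      rewrite !mxE -/s -/r; ring.
    by rewrite !mxE su// sv// !mulr0 addr0 mulr0.
  have {}h : 0 <= - r * G u + s * G v.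
    by apply: le_trans h; rewrite mulr_ge0// ltW.
  rewrite ler_pdivlMr// mulrAC ler_ndivrMr//; lra.
pose E := [set G v / v ord0 K | v in [set v | supp v /\ v ord0 K < 0]].
have eK : (delta_mx ord0 K : 'rV[R]_d) ord0 K = 1 by rewrite mxE !eqxx.
have se : supp (delta_mx ord0 K).
  move=> l kl; rewrite mxE /=; case: eqP => // lK.
  by move: kl; rewrite lK ltnn.
have nE : E !=set0.
  exists (G (- delta_mx ord0 K) / (- delta_mx ord0 K : 'rV[R]_d) ord0 K).
  exists (- delta_mx ord0 K) => //; split; last by rewrite mxE eK; lra.
  by move=> l kl; rewrite mxE se// oppr0.
have uE u : supp u -> 0 < u ord0 K -> ubound E (G u / u ord0 K).
  by move=> su u0 _ [v [sv v0] <-]; exact: key.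
(* A number separating the two families of slopes: an upper bound of [E] serves the case
   [v ord0 K < 0], and leastness serves [v ord0 K > 0]. When the coordinate is 0, the old minorant
   suffices. *)
pose a := sup E.
exists (g + a *: delta_mx ord0 K) => v sv.
rewrite dotvDl dotvZl dotv_delta.
suff : a * v ord0 K <= G v by rewrite /G; lra.
have [v0|v0|v0] := ltgtP (v ord0 K) 0.
- rewrite -ler_ndivrMr//; apply: ub_le_sup; last by exists v.
  exists (G (delta_mx ord0 K) / (delta_mx ord0 K : 'rV[R]_d) ord0 K).
  by apply: uE; rewrite // eK.
- by rewrite -ler_pdivlMr//; apply: ge_sup => //; exact: uE.
- rewrite v0 mulr0 /G -addrA -opprD subr_ge0; apply: hg => l.
  rewrite leq_eqVlt => /predU1P[kl|]; last exact: sv.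
  by have -> : l = K by apply: val_inj.
Qed.

Lemma convex_subdifferential_nonempty f z :
  convex_function [set: 'rV[R]_d] f -> subdifferential f z !=set0.
Proof.
move=> cf; have [g hg] := subgradient_partial z cf (leqnn d).
exists g => x; rewrite -[in leRHS](subrKC z x); apply: hg => l.
by rewrite leqNgt ltn_ord.
Qed.

(** A subgradient [g] at [x] gives [f x - f z <= dotv g (x - z)], and duality of the norms bounds
    the right-hand side. *)
Lemma convex_lipschitz f (L : R) : convex_function [set: 'rV[R]_d] f ->
  (forall z g, subdifferential f z g -> norm1 g <= L) ->
  forall x z, f x - f z <= L * `|x - z|.
Proof.
move=> cf fL x z; have [g gx] := convex_subdifferential_nonempty x cf.
have := gx z; rewrite -opprB dotvNr => h.
have := le_trans (ler_norm _) (dotv_le g (x - z)).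
have := ler_wpM2r (normr_ge0 (x - z)) (fL _ _ gx); lra.
Qed.

Lemma subgrad_bound_fin f : (subgrad_bound f < +oo)%E ->
  exists2 L : R, 0 <= L & forall z g, subdifferential f z g -> norm1 g <= L.
Proof.
move=> foo; have gle z g : subdifferential f z g ->
    ((norm1 g)%:E <= subgrad_bound f)%E.
  move=> gz; apply: (@le_trans _ _
    (ereal_sup [set (norm1 g)%:E | g in subdifferential f z])).
    by apply: ereal_sup_ubound; exists g.
  by apply: ereal_sup_ubound; exists z.
(* The maximum with 0 makes the constant nonnegative without exhibiting a subgradient. *)
exists (Num.max 0 (fine (subgrad_bound f))).
  by rewrite le_max lexx.
move=> z g gz; rewrite le_max; apply/orP; right.
move: (gle _ _ gz) foo; by case: (subgrad_bound f).
Qed.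

End subgradients.

(** * Summability, recursive inequalities and the step sizes *)

Section bounded_sums.
Context {R : realType}.
Implicit Types (u v b D S : nat -> R) (a B : R).

(** For nonnegative sequences this is summability; bounding partial sums allows termwise comparison
    without limits. *)
Definition bounded_sums u : Prop :=
  exists B, forall n, \sum_(i < n) u i <= B.

Lemma bounded_sums_le u v :
  (forall n, u n <= v n) -> bounded_sums v -> bounded_sums u.
Proof.
move=> uv [B vB]; exists B => n.
by apply: le_trans (vB n); apply: ler_sum => i _.
Qed.

Lemma bounded_sumsD u v :
  bounded_sums u -> bounded_sums v -> bounded_sums (fun n => u n + v n).
Proof.
by move=> [B uB] [C vC]; exists (B + C) => n; rewrite big_split lerD.
Qed.

Lemma bounded_sumsZ a u :
  0 <= a -> bounded_sums u -> bounded_sums (fun n => a * u n).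
Proof.
by move=> a0 [B uB]; exists (a * B) => n; rewrite -mulr_sumr ler_wpM2l.
Qed.

Lemma bounded_sums_shift k u :
  (forall n, 0 <= u n) -> bounded_sums u -> bounded_sums (fun n => u (n + k)%N).
Proof.
move=> u0 [B uB]; exists B => n; apply: le_trans (uB (k + n)%N).
rewrite big_split_ord/= ler_wpDl ?sumr_ge0//; apply: ler_sum => i _.
by rewrite addnC.
Qed.

Lemma bounded_sums_unshift k u :
  (forall n, 0 <= u n) -> bounded_sums (fun n => u (n + k)%N) -> bounded_sums u.
Proof.
move=> u0 [B uB]; exists (\sum_(i < k) u i + B) => n.
apply: (@le_trans _ _ (\sum_(i < k + n) u i)).
  by rewrite addnC big_split_ord/= lerDl sumr_ge0.
rewrite big_split_ord lerD2l; apply: le_trans (uB n); apply: ler_sum => i _.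
by rewrite (addnC i).
Qed.

Lemma bounded_sums_sqrD u v :
  bounded_sums (fun n => u n ^+ 2) -> bounded_sums (fun n => v n ^+ 2) ->
  bounded_sums (fun n => (u n + v n) ^+ 2).
Proof.
move=> bu bv; have two0 : 0 <= 2 :> R by [].
apply: bounded_sums_le (bounded_sumsZ two0 (bounded_sumsD bu bv)) => n.
by have := sqr_ge0 (u n - v n); lra.
Qed.

(** From [u * v <= (u^2 + v^2) / 2]; it makes the product of step size and diameter summable. *)
Lemma bounded_sumsM u v :
  bounded_sums (fun n => u n ^+ 2) -> bounded_sums (fun n => v n ^+ 2) ->
  bounded_sums (fun n => u n * v n).
Proof.
move=> bu bv; have half0 : 0 <= 2^-1 :> R by rewrite invr_ge0.
apply: bounded_sums_le (bounded_sumsZ half0 (bounded_sumsD bu bv)) => n.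
by have := sqr_ge0 (u n - v n); lra.
Qed.

Lemma bounded_sums_cvg u : (forall n, 0 <= u n) -> bounded_sums u ->
  cvgn (fun n => \sum_(i < n) u i).
Proof.
move=> u0 [B uB]; apply: nondecreasing_is_cvgn.
  by apply/nondecreasing_seqP => n; rewrite big_ord_recr lerDl.
by exists B => _ [n _ <-].
Qed.

Lemma bounded_sums_cvg0 u : (forall n, 0 <= u n) -> bounded_sums u ->
  u n @[n --> \oo] --> 0.
Proof.
move=> u0 /(bounded_sums_cvg u0) h; apply: cvg_series_cvg_0.
by rewrite /series /=; under eq_fun do rewrite big_mkord.
Qed.

(* Summing D(t+T)^2 <= (1-eta) D(t)^2 + S(t)^2/eta, which is the convexity of the
   square, bounds eta times the partial sums of D^2. *)
Lemma contraction_sqr_sums (T : nat) (eta : R) D S :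
  0 < eta <= 1 -> (forall n, 0 <= D n) ->
  (forall n, D (n + T)%N <= (1 - eta) * D n + S n) ->
  bounded_sums (fun n => S n ^+ 2) -> bounded_sums (fun n => D n ^+ 2).
Proof.
move=> /andP[e0 e1] D0 DS [B SB].
pose C := \sum_(i < T) D i ^+ 2.
have DS2 n : D (n + T)%N ^+ 2 <= (1 - eta) * D n ^+ 2 + eta^-1 * S n ^+ 2.
  apply: (@le_trans _ _ (((1 - eta) * D n + S n) ^+ 2)).
    by rewrite lerXn2r ?nnegrE//; exact: le_trans (DS n).
  (* The gap in the convexity inequality is an exact nonnegative multiple of a square. *)
  rewrite -subr_ge0; have -> : (1 - eta) * D n ^+ 2 + eta^-1 * S n ^+ 2 -
    ((1 - eta) * D n + S n) ^+ 2 = (1 - eta) / eta * (eta * D n - S n) ^+ 2.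
    by field; rewrite gt_eqF.
  by rewrite mulr_ge0 ?sqr_ge0// divr_ge0 ?(ltW e0)// subr_ge0.
exists (eta^-1 * (C + eta^-1 * B)) => n.
rewrite ler_pdivlMl//.
(* Shifting the index by [T] costs only the first [T] terms, which make up [C]; together with [h2],
   absorbing the factor [1 - eta] leaves [eta] times the sum on the left. *)
have h1 : \sum_(i < n) D i ^+ 2 <= C + \sum_(i < n) D (i + T)%N ^+ 2.
  apply: (@le_trans _ _ (\sum_(i < T + n) D i ^+ 2)).
    rewrite addnC big_split_ord/= lerDl; apply: sumr_ge0 => i _.
    exact: sqr_ge0.
  by rewrite big_split_ord lerD//; apply: ler_sum => i _; rewrite (addnC i).
have h2 : \sum_(i < n) D (i + T)%N ^+ 2 <=
    (1 - eta) * (\sum_(i < n) D i ^+ 2) + eta^-1 * B.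
  apply: (@le_trans _ _ ((1 - eta) * (\sum_(i < n) D i ^+ 2) +
    eta^-1 * \sum_(i < n) S i ^+ 2)).
    by rewrite !mulr_sumr -big_split; apply: ler_sum => i _.
  by rewrite lerD2l ler_wpM2l// invr_ge0 ltW.
lra.
Qed.

(** Telescoping bounds the sums of [u]. Subtracting the partial sums of [b] from [V] gives a
    nonincreasing sequence bounded below, and adding the convergent sums back keeps convergence. *)
Lemma quasi_fejer (V u b : nat -> R) :
  (forall n, 0 <= V n) -> (forall n, 0 <= u n) -> (forall n, 0 <= b n) ->
  (forall n, V n.+1 <= V n - u n + b n) -> bounded_sums b ->
  cvgn V /\ bounded_sums u.
Proof.
move=> V0 u0 b0 Vu bb; have [B bB] := bb; split; last first.
  exists (V 0%N + B) => n.
  suff : V n + \sum_(i < n) u i <= V 0%N + \sum_(i < n) b i.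
    by have := V0 n; have := bB n; lra.
  elim: n => [|n IH]; first by rewrite !big_ord0.
  by rewrite !big_ord_recr/=; have := Vu n; lra.
have c1 : cvgn (fun n => V n - \sum_(i < n) b i).
  apply: nonincreasing_is_cvgn.
    apply/nonincreasing_seqP => n; rewrite big_ord_recr/=.
    by have := Vu n; have := u0 n; lra.
  by exists (- B) => _ [n _ <-]; have := V0 n; have := bB n; lra.
have -> : V = (fun n => V n - \sum_(i < n) b i) + (fun n => \sum_(i < n) b i).
  by apply/funext => n; rewrite /= subrK.
by apply: is_cvgD => //; exact: bounded_sums_cvg.
Qed.

(** Cauchy condensation: the block of indices from [2^k] to [2^(k+1) - 1] has [2^k] terms, each at
    most [c^2 * r^(2k)], so blocks decay geometrically with ratio [q = 2^(1 + 2 alpha) < 1]. *)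
Lemma bounded_norm_sqr_powR (theta : nat -> R) (alpha c : R) :
  alpha < - (1 / 2) ->
  (forall t : nat, (1 <= t)%N -> theta t = c * t%:R `^ alpha) ->
  bounded_sums (fun t => theta t ^+ 2).
Proof.
move=> alpha_lt thetaE.
pose r : R := 2 `^ alpha; pose q : R := 2 * r ^+ 2.
have r0 : 0 <= r by exact: powR_ge0.
have q0 : 0 <= q by rewrite mulr_ge0// sqr_ge0.
have q1 : q < 1.
  rewrite /q /r -powR_mulrn ?powR_ge0// -powRrM.
  rewrite -[X in X * _](@powRr1 R 2)// -powRD; last by rewrite pnatr_eq0 implybT.
  rewrite -[X in 2 `^ X]opprK powRN invf_lt1 ?powR_gt0//.
  have s0 : 0 < - (1 + alpha * 2%:R) by lra.
  suff : 1 `^ (- (1 + alpha * 2%:R)) < 2 `^ (- (1 + alpha * 2%:R)) :> R.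
    by rewrite powR1.
  by apply: (gt0_ltr_powR s0); rewrite ?nnegrE ?ltr1n.
have powk k : (2 ^ k)%N%:R `^ alpha = r ^+ k.
  by rewrite natrX -powR_mulrn// -powRrM mulrC powRrM powR_mulrn ?powR_ge0.
have le_pow (s t : nat) : (0 < s)%N -> (s <= t)%N ->
    t%:R `^ alpha <= s%:R `^ alpha.
  move=> s0 st; rewrite -(opprK alpha) !(powRN _ (- alpha)).
  rewrite lef_pV2 ?posrE ?powR_gt0 ?ltr0n//; last exact: leq_trans st.
  have a0 : 0 <= - alpha by lra.
  by apply: (ge0_ler_powR a0); rewrite ?nnegrE ?ler_nat.
(* [theta 0] is outside the power law and is kept apart; the other blocks add up to a geometric
   sum. *)
have dyadic k : \sum_(i < 2 ^ k) theta i ^+ 2 <=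
    theta 0%N ^+ 2 + c ^+ 2 * ((1 - q ^+ k) / (1 - q)).
  elim: k => [|k IH].
    by rewrite expn0 big_ord1 expr0 subrr mul0r mulr0 addr0.
  rewrite expnS mul2n -addnn big_split_ord/=.
  have -> : c ^+ 2 * ((1 - q ^+ k.+1) / (1 - q)) =
      c ^+ 2 * ((1 - q ^+ k) / (1 - q)) + c ^+ 2 * q ^+ k.
    rewrite (exprS q); move: q q1 (q ^+ k) {q0 IH} => p p1 P.
    by field; rewrite subr_eq0 gt_eqF.
  rewrite addrA lerD//.
  apply: (@le_trans _ _ (\sum_(i < 2 ^ k) c ^+ 2 * (r ^+ k) ^+ 2)).
    apply: ler_sum => i _; rewrite thetaE ?addn_gt0 ?expn_gt0// exprMn.
    rewrite ler_wpM2l ?sqr_ge0// lerXn2r ?nnegrE ?powR_ge0 ?exprn_ge0//.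
    by rewrite -powk le_pow ?expn_gt0// leq_addr.
  rewrite sumr_const card_ord -mulr_natr natrX.
  by rewrite /q exprMn -exprM mulnC exprM -mulrA [X in _ * X]mulrC.
exists (theta 0%N ^+ 2 + c ^+ 2 / (1 - q)) => n.
have nk : (n <= 2 ^ n)%N by rewrite ltnW// ltn_expl.
apply: (@le_trans _ _ (\sum_(i < 2 ^ n) theta i ^+ 2)).
  rewrite -(subnKC nk) big_split_ord lerDl; apply: sumr_ge0 => i _.
  exact: sqr_ge0.
apply: le_trans (dyadic n) _; rewrite lerD2l ler_wpM2l ?sqr_ge0//.
have q10 : 0 < 1 - q by lra.
by rewrite ler_pdivrMr// mulVf ?gt_eqF// gerBl exprn_ge0.
Qed.

(** Since [alpha >= -1], [theta t] is at least [c / t], and the harmonic series diverges. *)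
Lemma unbounded_sums_powR (theta : nat -> R) (alpha c : R) :
  -1 <= alpha -> 0 < c -> 0 <= theta 0%N ->
  (forall t : nat, (1 <= t)%N -> theta t = c * t%:R `^ alpha) ->
  ~ bounded_sums theta.
Proof.
move=> alpha_ge c0 t0 thetaE bt.
have th0 n : 0 <= theta n.
  by case: n => // n; rewrite thetaE// mulr_ge0 ?powR_ge0 ?(ltW c0).
have hge0 n : 0 <= @harmonic R n by exact: harmonic_ge0.
apply: (@dvg_harmonic R); rewrite /series /=.
under eq_fun do rewrite big_mkord.
apply: (bounded_sums_cvg hge0).
have ci0 : 0 <= c^-1 by rewrite invr_ge0 ltW.
(* [harmonic n] is the inverse of [n + 1], hence the shift by 1. *)
apply: bounded_sums_le (bounded_sumsZ ci0 (bounded_sums_shift 1 th0 bt)) => n.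
rewrite addn1 thetaE// mulrA mulVf ?gt_eqF// mul1r.
by rewrite -[leLHS]powR_inv1// ler_powR// ler1n.
Qed.

End bounded_sums.

(** * Products of column-stochastic matrices and the push-sum weights *)

Section stochastic_matrices.
Context {R : realType} {N : nat}.
Implicit Types (M : 'M[R]_N) (A : nat -> 'M[R]_N).

Lemma finite_pos_lower_bound (I : finType) (F : I -> R) :
  (forall i, 0 < F i) -> exists2 m, 0 < m & forall i, m <= F i.
Proof.
move=> F0; exists (\big[Order.min/1]_i F i).
  by apply/bigmin_gtP; split.
by move=> i; exact: bigmin_le.
Qed.

Lemma inf_positive_entry_gt0 A : (0 < inf_positive_entry A)%E ->
  exists2 a, 0 < a & forall t i j, 0 < A t i j -> a <= A t i j.
Proof.
move=> A0; have leA t i j : 0 < A t i j ->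
    (inf_positive_entry A <= (A t i j)%:E)%E.
  move=> Aij; apply: (@le_trans _ _ (min_positive_entry (A t))).
    by apply: ereal_inf_lbound; exists t.
  exact: (@bigmin_le_cond _ _ _ _ (i, j)
    (fun ij : 'I_N * 'I_N => 0 < A t ij.1 ij.2)
    (fun ij : 'I_N * 'I_N => (A t ij.1 ij.2)%:E)).
case: (inf_positive_entry A) A0 leA => [a||]// a0 leA.
  by exists a => // t i j /leA; rewrite lee_fin.
(* By [leA], an infimum [+oo] rules out positive entries, so any positive constant serves. *)
by exists 1 => // t i j /leA.
Qed.

Lemma no_zero_row_pos M i :
  column_stochastic M -> no_zero_row M -> exists j, 0 < M i j.
Proof.
move=> [M0 _] /(_ i) Mi; apply/existsP; apply: contraNT Mi.
rewrite negb_exists => /forallP Mi; apply/eqP/rowP => j; rewrite !mxE.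
by apply/eqP; rewrite eq_le M0 leNgt Mi.
Qed.

Section products.
Variable A : nat -> 'M[R]_N.
Hypothesis A_stoch : forall t, column_stochastic (A t).

Lemma backward_product_stochastic t k :
  column_stochastic (backward_product A t k).
Proof.
elim: k => [|k [B0 B1]] /=.
  split=> [i j|j]; first by rewrite mxE ler0n.
  rewrite (bigD1 j)//= mxE eqxx big1 ?addr0// => i /negPf ij.
  by rewrite mxE ij.
have [A0 A1] := A_stoch (t + k)%N; split=> [i j|j].
  by rewrite mxE sumr_ge0// => l _; rewrite mulr_ge0.
under eq_bigr do rewrite mxE; rewrite exchange_big/= -(B1 j).
by apply: eq_bigr => l _; rewrite -mulr_suml A1 mul1r.
Qed.

(** A positive entry is a sum of nonnegative path weights, at least one positive; that path has [k]
    factors, each at least [a]. This makes positivity of the products uniform in time. *)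
Lemma backward_product_entry_ge a t k i j : 0 < a ->
  (forall s i j, 0 < A s i j -> a <= A s i j) ->
  0 < backward_product A t k i j -> a ^+ k <= backward_product A t k i j.
Proof.
move=> a0 aA; elim: k i j => [|k IH] i j /=.
  by rewrite mxE expr0; case: eqP; rewrite ?ltxx.
have [B0 _] := backward_product_stochastic t k.
have [A0 _] := A_stoch (t + k)%N.
rewrite mxE => s0; have [l lpos] : exists l,
    0 < A (t + k)%N i l * backward_product A t k l j.
  apply/existsP; apply: contraTT s0; rewrite negb_exists => /forallP h.
  rewrite -leNgt; apply: sumr_le0 => l _; by rewrite leNgt h.
have Bl : 0 < backward_product A t k l j.
  rewrite lt_def B0 andbT; apply: contraTneq lpos => ->.
  by rewrite mulr0 ltxx.
have Al : 0 < A (t + k)%N i l.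
  by rewrite -(pmulr_lgt0 _ Bl).
rewrite (bigD1 l)//= exprS ler_wpDr ?sumr_ge0// => [m _|].
  by rewrite mulr_ge0.
by apply: ler_pM; rewrite ?(ltW a0) ?exprn_ge0 ?(ltW a0) ?aA ?IH.
Qed.

Section weights.
Variable y : nat -> 'I_N -> R.
Hypothesis A_rows : forall t, no_zero_row (A t).
Hypothesis y0_gt0 : forall i, 0 < y 0%N i.
Hypothesis y_rec : forall t i, y t.+1 i = \sum_(j < N) A t i j * y t j.

Lemma weight_gt0 t i : 0 < y t i.
Proof.
elim: t i => [//|t IH] i; rewrite y_rec.
have [l Al] := no_zero_row_pos i (A_stoch t) (@A_rows t).
have [A0 _] := A_stoch t.
rewrite (bigD1 l)//= ltr_wpDr ?mulr_gt0// sumr_ge0// => m _.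
by rewrite mulr_ge0// ltW.
Qed.

Lemma weight_sum t : \sum_i y t i = \sum_i y 0%N i.
Proof.
elim: t => [//|t <-]; under eq_bigr do rewrite y_rec.
rewrite exchange_big/=; apply: eq_bigr => j _.
by rewrite -mulr_suml (A_stoch t).2 mul1r.
Qed.

Lemma weight_backward_product t k i :
  y (t + k)%N i = \sum_j backward_product A t k i j * y t j.
Proof.
elim: k i => [|k IH] i.
  rewrite addn0 (bigD1 i)//= mxE eqxx mul1r big1 ?addr0// => j /negPf ij.
  by rewrite mxE eq_sym ij mul0r.
rewrite addnS y_rec; under eq_bigr do rewrite IH mulr_sumr.
rewrite exchange_big/=; apply: eq_bigr => j _; rewrite mxE mulr_suml.
by apply: eq_bigr => l _; rewrite mulrA.
Qed.

(** From time [T] on, each weight is at least [a] times the conserved total mass; the finitely many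
    earlier weights have a positive minimum [m]. *)
Lemma weight_lower_bound a T : 0 < a ->
  (forall t i j, a <= backward_product A t T i j) ->
  exists2 delta, 0 < delta & forall t i, delta <= y t i.
Proof.
move=> a0 aB.
have [m m0 my] := @finite_pos_lower_bound ('I_T * 'I_N)%type
  (fun p => y p.1 p.2) (fun p => weight_gt0 _ _).
have Y0 : 0 <= \sum_i y 0%N i by apply: sumr_ge0 => i _; exact: ltW.
have [N0|N0] := leqP N 0.
  by exists 1 => // t i; have := leq_trans (ltn_ord i) N0.
have Yp : 0 < \sum_i y 0%N i.
  rewrite (bigD1 (Ordinal N0))//= ltr_wpDr// sumr_ge0// => i _; exact: ltW.
exists (Num.min m (a * \sum_i y 0%N i)).
  by rewrite lt_min m0 mulr_gt0.
move=> t i; rewrite ge_min; have [tT|Tt] := ltnP t T.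
  by rewrite (my (Ordinal tT, i)).
apply/orP; right; rewrite -(subnK Tt) weight_backward_product.
rewrite -(weight_sum (t - T)) mulr_sumr; apply: ler_sum => j _.
by rewrite ler_wpM2r ?aB// ltW// weight_gt0.
Qed.

End weights.
End products.
End stochastic_matrices.

(** * Contraction of the diameter under averaging *)

Section consensus.
Context {R : realType} {N d : nat}.

(** The difference of the two averages is the average of [z j - z k] with weights [p j * q k].
    Diagonal terms vanish, which removes mass [q j >= eta] from each inner sum. *)
Lemma scrambling (p q : 'I_N -> R) (z : 'I_N -> 'rV[R]_d) (eta D : R) :
  (forall j, 0 <= p j) -> \sum_j p j = 1 ->
  (forall j, 0 <= q j) -> \sum_j q j = 1 -> (forall j, eta <= q j) ->
  (forall j k, `|z j - z k| <= D) ->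
  `|\sum_j p j *: z j - \sum_j q j *: z j| <= (1 - eta) * D.
Proof.
move=> p0 p1 q0 q1 qeta zD.
have -> : \sum_j p j *: z j - \sum_j q j *: z j =
    \sum_j p j *: \sum_k q k *: (z j - z k).
  under [RHS]eq_bigr => j _.
    under eq_bigr do rewrite scalerBr.
    rewrite sumrB -scaler_suml q1 scale1r scalerBr; over.
  by rewrite sumrB -[X in _ = _ - X]scaler_suml p1 scale1r.
apply: le_trans (ler_norm_sum _ _ _) _.
rewrite -[leRHS]mul1r -[X in _ <= X * _]p1 mulr_suml; apply: ler_sum => j _.
rewrite normrZ ger0_norm// ler_wpM2l//.
apply: le_trans (ler_norm_sum _ _ _) _.
rewrite (bigD1 j)//= subrr scaler0 normr0 add0r.
apply: (@le_trans _ _ (\sum_(k < N | k != j) q k * D)).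
  by apply: ler_sum => k _; rewrite normrZ ger0_norm// ler_wpM2l.
have D0 : 0 <= D by apply: le_trans (zD j j).
rewrite -mulr_suml ler_wpM2r// -q1 [in leRHS](bigD1 j)//=.
by have := qeta j; lra.
Qed.

(** * Square summability of the diameter of the push-sum ratios *)

Section push_sum.
Variables (A : nat -> 'M[R]_N) (theta : nat -> R) (L : R).
Variables (y : nat -> 'I_N -> R) (w g : nat -> 'I_N -> 'rV[R]_d).
Hypothesis A_stoch : forall t, column_stochastic (A t).
Hypothesis theta_ge0 : forall t, 0 <= theta t.
Hypothesis gL : forall t i, norm1 (g t i) <= L.
Hypothesis y_gt0 : forall t i, 0 < y t i.
Hypothesis y_rec : forall t i, y t.+1 i = \sum_(j < N) A t i j * y t j.
Hypothesis w_rec : forall t i,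
  w t.+1 i = \sum_(j < N) A t i j *: w t j - theta t *: g t i.

Let z t i := (y t i)^-1 *: w t i.

Definition diameter t : R :=
  \big[Num.max/0]_(ij : 'I_N * 'I_N) `|z t ij.1 - z t ij.2|.

Lemma diameter_ge0 t : 0 <= diameter t.
Proof. by rewrite /diameter; apply/bigmax_geP; left. Qed.

Lemma le_diameter t i j : `|z t i - z t j| <= diameter t.
Proof.
exact: (le_bigmax _ (fun ij : 'I_N * 'I_N => `|z t ij.1 - z t ij.2|) (i, j)).
Qed.

(** The error is summed over all agents because column-stochastic matrices do not increase that sum;
    each step then adds at most [N * L] times its step size. *)
Lemma push_deviation t k :
  \sum_i `|w (t + k)%N i - \sum_j backward_product A t k i j *: w t j| <=
  N%:R * L * \sum_(s < k) theta (t + s)%N.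
Proof.
pose E k i := w (t + k)%N i - \sum_j backward_product A t k i j *: w t j.
rewrite -/(E k); elim: k => [|k IH].
  rewrite big_ord0 mulr0 big1// => i _; rewrite /E addn0 (bigD1 i)//= mxE eqxx.
  rewrite scale1r big1 ?addr0 ?subrr ?normr0// => j /negPf ij.
  by rewrite mxE eq_sym ij scale0r.
have [A0 A1] := A_stoch (t + k)%N.
(* The error follows the same recursion as [w]. *)
have ES i : E k.+1 i =
    \sum_j A (t + k)%N i j *: E k j - theta (t + k)%N *: g (t + k)%N i.
  rewrite /E addnS w_rec addrAC; congr (_ - _).
  under [RHS]eq_bigr do rewrite scalerBr scaler_sumr.
  rewrite sumrB; congr (_ - _); rewrite exchange_big/=; apply: eq_bigr => l _.
  by rewrite mxE scaler_suml; apply: eq_bigr => m _; rewrite scalerA.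
rewrite big_ord_recr/= mulrDr.
apply: (@le_trans _ _ (\sum_i (
  \sum_j A (t + k)%N i j * `|E k j| + theta (t + k)%N * L))).
  apply: ler_sum => i _; rewrite -[w _ _ - _]/(E k.+1 i) ES.
  apply: le_trans (ler_normB _ _) _.
  apply: lerD.
    apply: le_trans (ler_norm_sum _ _ _) _; apply: ler_sum => j _.
    by rewrite normrZ ger0_norm.
  rewrite normrZ ger0_norm// ler_wpM2l//.
  exact: le_trans (norm_le_norm1 _) (gL _ _).
rewrite big_split/= lerD//.
  apply: le_trans IH; rewrite exchange_big/=; apply: ler_sum => j _.
  by rewrite -mulr_suml A1 mul1r.
rewrite sumr_const card_ord -[(_ * L) *+ N]mulr_natl.
by rewrite [theta _ * L]mulrC mulrA.
Qed.

(** Over [T] steps the ratios undergo a row-stochastic averaging with weights at least [eta], up to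
    an error [S t / 2] per agent; [scrambling] then yields the recursion of
    [contraction_sqr_sums]. *)
Lemma diameter_sqr_sums (a delta : R) (T : nat) :
  0 < a -> (forall t i j, a <= backward_product A t T i j) ->
  0 < delta -> (forall t i, delta <= y t i) ->
  bounded_sums (fun t => theta t ^+ 2) ->
  bounded_sums (fun t => diameter t ^+ 2).
Proof.
move=> a0 aB delta0 ydelta theta2.
pose Y := \sum_i y 0%N i.
have yY t i : y t i <= Y.
  rewrite /Y -(weight_sum A_stoch y_rec t) (bigD1 i)//= lerDl.
  by apply: sumr_ge0 => j _; exact: ltW.
have [N0|N0] := leqP N 0.
  exists 0 => n; rewrite big1// => t _; have -> : diameter t = 0; last first.
    by rewrite expr0n.
  apply/eqP; rewrite eq_le diameter_ge0 andbT; apply: bigmax_le => // -[i] j _.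
  by have := leq_trans (ltn_ord i) N0.
pose i0 := Ordinal N0.
have Y0 : 0 < Y by exact: lt_le_trans (yY 0%N i0).
have L0 : 0 <= L by exact: le_trans (norm1_ge0 _) (gL 0%N i0).
(* [a] bounds the product entry, [delta] the weight multiplying it, and [Y] the weight dividing it;
   the minimum keeps [1 - eta] nonnegative. *)
pose eta := Num.min 1 (a * delta / Y).
have eta0 : 0 < eta <= 1.
  by rewrite lt_min ltr01/= ge_min lexx/= divr_gt0 ?mulr_gt0.
(* The 2 counts both endpoints of a pair; [delta^-1] comes from dividing the deviation of [w] by the
   weight. *)
pose C := 2 * (delta^-1 * (N%:R * L)).
have C0 : 0 <= C.
  by rewrite /C !mulr_ge0// invr_ge0 ltW.
pose S t := C * \sum_(s < T) theta (t + s)%N.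
(* Substituting [w t j = y t j *: z t j] moves the weights into the coefficients; rows sum to 1
   because [y] obeys the same products. *)
pose Q t i j := backward_product A t T i j * y t j / y (t + T)%N i.
have Q1 t i : \sum_j Q t i j = 1.
  by rewrite /Q -mulr_suml -(weight_backward_product y_rec) divff// gt_eqF.
have Qeta t i j : eta <= Q t i j.
  rewrite /eta ge_min; apply/orP; right.
  rewrite ler_pM ?invr_ge0 ?mulr_ge0 ?(ltW a0) ?(ltW delta0) ?(ltW Y0)//.
    by rewrite ler_pM ?(ltW a0) ?(ltW delta0).
  by rewrite lef_pV2 ?posrE.
have Q0 t i j : 0 <= Q t i j.
  by apply: le_trans (Qeta t i j); case/andP: eta0 => /ltW.
have zQ t i : `|z (t + T)%N i - \sum_j Q t i j *: z t j| <= S t / 2.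
  have -> : \sum_j Q t i j *: z t j =
      (y (t + T)%N i)^-1 *: \sum_j backward_product A t T i j *: w t j.
    rewrite scaler_sumr; apply: eq_bigr => j _.
    rewrite /z /Q !scalerA; congr (_ *: _); field.
    by rewrite !gt_eqF.
  rewrite /z -scalerBr normrZ gtr0_norm ?invr_gt0//.
  have -> : S t / 2 = delta^-1 * (N%:R * L * \sum_(s < T) theta (t + s)%N).
    by rewrite /S /C; field; rewrite gt_eqF.
  rewrite ler_pM ?invr_ge0 ?(ltW (y_gt0 _ _))//.
    by rewrite lef_pV2 ?posrE.
  apply: le_trans (push_deviation t T).
  by rewrite [leRHS](bigD1 i)//= lerDl sumr_ge0.
apply: (@contraction_sqr_sums _ T eta _ S eta0 diameter_ge0) => [t|].
  have S0 : 0 <= S t by rewrite mulr_ge0// sumr_ge0.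
  have eta1 : 0 <= 1 - eta by case/andP: eta0 => _; lra.
  apply: bigmax_le => [|[i j] _ /=].
    by rewrite addr_ge0// mulr_ge0// diameter_ge0.
  have := scrambling (Q0 t i) (Q1 t i) (Q0 t j) (Q1 t j) (Qeta t j)
    (le_diameter t).
  have := zQ t i; have := zQ t j; rewrite (distrC (z _ j)).
  set zi := z _ i; set zj := z _ j.
  set p := \sum_k Q t i k *: _; set q := \sum_k Q t j k *: _.
  move=> hj hi hpq.
  have -> : zi - zj = (zi - p) + (p - q) + (q - zj).
    by rewrite !addrA !subrK.
  apply: le_trans (ler_normD _ _) _.
  by have := ler_normD (zi - p) (p - q); lra.
have C20 : 0 <= C ^+ 2 by exact: sqr_ge0.
under [X in bounded_sums X]eq_fun do rewrite exprMn.
(* Induction on the window length: each added term is a shift of [theta], whose squares are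
   summable. *)
apply: bounded_sumsZ => //; elim: (T) => [|k IH].
  by exists 0 => n; rewrite big1// => t _; rewrite big_ord0 expr0n.
under [X in bounded_sums X]eq_fun do rewrite big_ord_recr/=.
apply: bounded_sums_sqrD => //.
apply: (@bounded_sums_shift _ k (fun t => theta t ^+ 2)) => // t.
exact: sqr_ge0.
Qed.

End push_sum.
End consensus.

(** * Convergence to a minimizer from Fejer monotonicity *)

Section opial.
Context {R : realType} {d : nat}.
Implicit Types (u : nat -> 'rV[R]_d) (F : 'rV[R]_d -> R).

Lemma bounded_seq_cluster u (M : R) :
  (forall n, `|u n| <= M) -> exists x : 'rV[R]_d, cluster (u n @[n --> \oo]) x.
Proof.
move=> uM.
have cK : compact [set v : 'rV[R]_d | forall i, v ord0 i \in `[- M, M]].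
  apply: (@rV_compact _ _ (fun=> `[- M, M]%classic)) => _.
  exact: segment_compact.
have [|x [_ xu]] := cK (u n @[n --> \oo]) _; last by exists x.
exists 0%N => // n _ i /=; rewrite in_itv/= -ler_norml.
exact: le_trans (coord_le_norm _ _) (uM n).
Qed.

(** Convergent distances bound [u]. A cluster point [x] of a subsequence along which [F] approaches
    its minimum is a minimizer by the Lipschitz bound; the distance from [u] to [x] then converges
    and is arbitrarily small along the subsequence, so its limit is 0. *)
Lemma opial_cvg u F (K : R) xmin :
  0 <= K -> (forall x v, F x - F v <= K * `|x - v|) -> minimizer F xmin ->
  (forall x, minimizer F x -> cvgn (fun n => dotv (u n - x) (u n - x))) ->
  (forall e : R, 0 < e ->
    forall n, exists2 m, (n <= m)%N & F (u m) < F xmin + e) ->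
  exists x, minimizer F x /\ u n @[n --> \oo] --> x.
Proof.
move=> K0 FK xminP ucvg Fu.
have /boolp.choice[s sP] n :
    exists m, (n <= m)%N /\ F (u m) < F xmin + n.+1%:R^-1.
  by have [|m] := Fu n.+1%:R^-1 _ n; [rewrite invr_gt0|exists m].
have [M uM] : exists M, forall n, `|u n| <= M.
  have /cvg_seq_bounded[B [_ /(_ (B + 1)) uB]] := ucvg _ xminP.
  have {}uB n : dotv (u n - xmin) (u n - xmin) <= B + 1.
    by apply: le_trans (uB _ n I); [exact: ler_norm|rewrite ltrDl].
  (* Uses [r <= 1 + r^2] to avoid a square root. *)
  exists (`|xmin| + (1 + (B + 1))) => n.
  rewrite -[u n](subrKC xmin); apply: le_trans (ler_normD _ _) _.
  rewrite lerD2l; have := le_trans (norm_sqr_le_dotv _) (uB n).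
  have := sqr_ge0 `|u n - xmin|; have := sqr_ge0 (`|u n - xmin| - 1); lra.
have [x xcl] := bounded_seq_cluster (fun n => uM (s n)).
have near_x (P : set nat) (e : R) : (\forall n \near \oo, P n) -> 0 < e ->
    exists2 n, P n & `|x - u (s n)| < e.
  move=> Poo e0; have := xcl [set u (s n) | n in P] (ball x e).
  case=> [||v [[n Pn <-]]].
  - by apply: filterS Poo => n Pn; exists n.
  - exact: nbhsx_ballx.
  - by rewrite -ball_normE /= => xv; exists n.
have xP : minimizer F x.
  move=> v; apply: le_trans (xminP v); apply/ler_addgt0Pr => /= e e0.
  (* Half of [e] pays for the Lipschitz error, half for the gap along [s]; [K + 1] stays positive
     when [K = 0]. *)
  have e2 : 0 < e / (2 * (K + 1)) by rewrite divr_gt0// mulr_gt0//; lra.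
  have e3 : 0 < e / 2 by lra.
  have [n ne un] := near_x _ _ (near_infty_natSinv_lt (PosNum e3)) e2.
  have := FK x (u (s n)); have := (sP n).2.
  have : (K + 1) * `|x - u (s n)| <= e / 2.
    rewrite -ler_pdivlMl; last by lra.
    apply: le_trans (ltW un) _; rewrite le_eqVlt; apply/predU1P; left.
    by field; rewrite gt_eqF//; lra.
  have /= {}ne : n.+1%:R^-1 < e / 2 := ne.
  move: ne (normr_ge0 (x - u (s n))); move: (`|x - u (s n)|) (n.+1%:R^-1) => r1 q1.
  move: (F (u (s n))) (F xmin) (F x) e0 => a1 a2 a3 e0. lra.
exists x; split => //.
have := ucvg x xP; set V := fun n => dotv _ _ => Vcvg.
have V0 n : 0 <= V n by exact: dotv_ge0.
have l0 : limn V <= 0.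
  apply/ler_addgt0Pr => /= e e0; rewrite add0r leNgt; apply/negP => eV.
  have [n0 _ Vn0] := cvgr_gt _ Vcvg _ eV.
  have n0P : \forall n \near \oo, (n0 <= n)%N by exists n0.
  (* A radius at most 1 replaces the squared distance by the distance, so [V (s n) <= e], against
     [Vn0]. *)
  pose r := Num.min 1 (e / (d%:R + 1)).
  have d0 : 0 <= d%:R :> R by [].
  have r0 : 0 < r by rewrite lt_min ltr01 divr_gt0//; lra.
  have [n /= n0n xun] := near_x _ r n0P r0.
  have := Vn0 _ (leq_trans n0n (sP n).1); apply/negP; rewrite -leNgt.
  apply: le_trans (dotv_le_norm_sqr _) _; rewrite -normrN opprB.
  have xu1 : `|x - u (s n)| <= 1.
    by apply: le_trans (ltW xun) _; rewrite ge_min lexx.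
  have xue : (d%:R + 1) * `|x - u (s n)| <= e.
    rewrite -ler_pdivlMl; last by lra.
    by apply: le_trans (ltW xun) _; rewrite ge_min mulrC lexx orbT.
  by have := normr_ge0 (x - u (s n)); nra.
apply/cvgrPdist_lt => e e0.
have e20 : limn V < e ^+ 2 by apply: le_lt_trans l0 _; rewrite exprn_gt0.
have [n0 _ Vn0] := cvgr_lt _ Vcvg _ e20.
exists n0 => // n n0n /=; rewrite -(@ltr_pXn2r _ 2)// ?nnegrE ?(ltW e0)//.
by rewrite -normrN opprB; apply: le_lt_trans (norm_sqr_le_dotv _) (Vn0 _ n0n).
Qed.

End opial.

(** Expand the square. Moving the subgradient inequality from [z i] to [v] costs [L * D] twice, once
    for the function value and once for the pairing; summing over agents and multiplying by [2 * s]
    gives the constant 4. *)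
Lemma subgradient_step {R : realType} {N d : nat} (f : 'I_N -> 'rV[R]_d -> R)
    (L D s : R) (z g : 'I_N -> 'rV[R]_d) (v x : 'rV[R]_d) :
  (forall i, subdifferential (f i) (z i) (g i)) ->
  (forall i, norm1 (g i) <= L) ->
  (forall i u u', f i u - f i u' <= L * `|u - u'|) ->
  (forall i, `|z i - v| <= D) -> 0 <= L -> 0 <= s ->
  dotv (v - s *: \sum_i g i - x) (v - s *: \sum_i g i - x) <=
    dotv (v - x) (v - x) - 2 * s * (\sum_i f i v - \sum_i f i x) +
    (4 * (N%:R * L) * s * D + (N%:R * L) ^+ 2 * s ^+ 2).
Proof.
move=> gz gL fL zv L0 s0; set G := \sum_i g i; set a := v - x.
have -> : v - s *: G - x = a - s *: G by rewrite addrAC.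
have -> : dotv (a - s *: G) (a - s *: G) =
    dotv a a - 2 * s * dotv G a + s ^+ 2 * dotv G G.
  move: (a) => b; rewrite dotvBr !(dotvC (b - _)) !dotvBr !dotvZl !dotvZr.
  by rewrite (dotvC b G); ring.
have NLD c : \sum_(i < N) c = N%:R * c :> R.
  by rewrite sumr_const card_ord mulr_natl.
have GG : dotv G G <= (N%:R * L) ^+ 2.
  have G1 : `|G| <= N%:R * L.
    rewrite -NLD; apply: le_trans (ler_norm_sum _ _ _) _; apply: ler_sum => i _.
    exact: le_trans (norm_le_norm1 _) (gL i).
  apply: (@le_trans _ _ (N%:R * L * `|G|)); last first.
    by rewrite expr2 ler_wpM2l// mulr_ge0.
  rewrite {1}/G dotv_suml -NLD mulr_suml; apply: ler_sum => i _.
  apply: le_trans (ler_norm _) _; apply: le_trans (dotv_le _ _) _.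
  by rewrite ler_wpM2r.
have Ga : \sum_i f i v - \sum_i f i x - 2 * (N%:R * (L * D)) <= dotv G a.
  rewrite /G dotv_suml -NLD mulr_sumr -!sumrB; apply: ler_sum => i _.
  have : f i (z i) + dotv (g i) (x - z i) <= f i x := gz i x.
  rewrite -[x - _]opprB dotvNr.
  have -> : a = (z i - x) - (z i - v) by rewrite /a opprB [RHS]addrC addrA subrK.
  rewrite dotvBr; have := le_trans (ler_norm _) (dotv_le (g i) (z i - v)).
  have := fL i v (z i); rewrite distrC.
  have : norm1 (g i) * `|z i - v| <= L * D by rewrite ler_pM ?norm1_ge0.
  have : L * `|z i - v| <= L * D by rewrite ler_wpM2l.
  lra.
have := ler_wpM2l (sqr_ge0 s) GG.
have := ler_wpM2l (mulr_ge0 (ler0n R 2) s0) Ga; nra.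
Qed.

(** * Assembly: consensus, descent of the mean and convergence *)

Theorem corollary5p3 (R : realType) (N d : nat) (hN : (1 <= N)%N)
    (hd : (1 <= d)%N)
    (f : 'I_N -> 'rV[R]_d -> R)
    (f_convex : forall i, convex_function [set: 'rV[R]_d] (f i))
    (f_subgrad : forall i, (subgrad_bound (f i) < +oo)%E)
    (f_min : exists x, minimizer (fun z => \sum_(i < N) f i z) x)
    (A : nat -> 'M[R]_N)
    (A_stoch : forall t, column_stochastic (A t))
    (A_rows : forall t, no_zero_row (A t))
    (A_inf : (0 < inf_positive_entry A)%E)
    (A_pos : exists T : nat, forall t, positive_mx (backward_product A t T))
    (alpha c : R) (alpha_ge : -1 <= alpha) (alpha_lt : alpha < - (1 / 2))
    (c_gt0 : 0 < c)
    (theta : nat -> R) (theta0 : 0 <= theta 0%N)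
    (thetaE : forall t : nat, (1 <= t)%N -> theta t = c * t%:R `^ alpha)
    (y : nat -> 'I_N -> R) (w g : nat -> 'I_N -> 'rV[R]_d)
    (y0_gt0 : forall i, 0 < y 0%N i)
    (y_rec : forall t i, y t.+1 i = \sum_(j < N) A t i j * y t j)
    (g_sub : forall t i,
        subdifferential (f i) ((y t i)^-1 *: w t i) (g t i))
    (w_rec : forall t i,
        w t.+1 i = \sum_(j < N) A t i j *: w t j - theta t *: g t i) :
  exists xstar : 'rV[R]_d,
    minimizer (fun z => \sum_(i < N) f i z) xstar /\
    forall i, (y t i)^-1 *: w t i @[t --> \oo] --> xstar.
Proof.
pose F v := \sum_(i < N) f i v; rewrite -/F in f_min *.
have [xmin xminP] := f_min.
have [L L0 fL] : exists2 L : R, 0 <= L &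
    forall i z g, subdifferential (f i) z g -> norm1 g <= L.
  have /boolp.choice[K KP] i : exists K : R, 0 <= K /\
      forall z g, subdifferential (f i) z g -> norm1 g <= K.
    by have [K K0 KP] := subgrad_bound_fin (f_subgrad i); exists K.
  (* The sum of the nonnegative constants dominates each of them. *)
  exists (\sum_i K i); first by apply: sumr_ge0 => i _; exact: (KP i).1.
  move=> i z h /(KP i).2 hK; apply: le_trans hK _.
  by rewrite (bigD1 i)//= lerDl sumr_ge0// => j _; exact: (KP j).1.
have fLip i u u' : f i u - f i u' <= L * `|u - u'|.
  exact: convex_lipschitz (f_convex i) (fL i) u u'.
have gL t i : norm1 (g t i) <= L by exact: fL (g_sub t i).
have theta_ge0 t : 0 <= theta t.
  by case: t => // t; rewrite thetaE// mulr_ge0 ?powR_ge0 ?(ltW c_gt0).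
have theta2 := bounded_norm_sqr_powR alpha_lt thetaE.
have thetaoo := unbounded_sums_powR alpha_ge c_gt0 theta0 thetaE.
have y_gt0 := weight_gt0 A_stoch A_rows y0_gt0 y_rec.
have [a [T [a0 aB]]] : exists (a : R) (T : nat), 0 < a /\
    forall t i j, a <= backward_product A t T i j.
  have [T TP] := A_pos; have [a a0 aA] := inf_positive_entry_gt0 A_inf.
  exists (a ^+ T), T; split; first by rewrite exprn_gt0.
  move=> t i j; apply: (backward_product_entry_ge A_stoch a0 aA).
  exact: TP.
have [delta delta0 ydelta] :=
  weight_lower_bound A_stoch A_rows y0_gt0 y_rec a0 aB.
pose D := diameter y w.
have D2 : bounded_sums (fun t => D t ^+ 2).
  exact: (diameter_sqr_sums A_stoch theta_ge0 gL y_gt0 y_rec w_rec a0 aB delta0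
    ydelta theta2).
have D0 t : 0 <= D t by exact: diameter_ge0.
pose Y := \sum_i y 0%N i.
have Y0 : 0 < Y.
  rewrite /Y (bigD1 (Ordinal hN))//= ltr_wpDr// sumr_ge0// => i _; exact: ltW.
pose z t i := (y t i)^-1 *: w t i.
pose u t := Y^-1 *: \sum_i w t i.
have zu t i : `|z t i - u t| <= D t.
  have yY : \sum_j Y^-1 * y t j = 1.
    by rewrite -mulr_sumr (weight_sum A_stoch y_rec) mulVf// gt_eqF.
  (* The mean [u t] is the convex combination of the ratios with weights [y t j / Y]. *)
  have -> : z t i - u t = \sum_j (Y^-1 * y t j) *: (z t i - z t j).
    under [RHS]eq_bigr do rewrite scalerBr.
    rewrite sumrB -scaler_suml yY scale1r; congr (_ - _).
    rewrite /u scaler_sumr; apply: eq_bigr => j _.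
    by rewrite /z scalerA mulfK// gt_eqF.
  apply: le_trans (ler_norm_sum _ _ _) _.
  rewrite -[leRHS]mul1r -[X in _ <= X * _]yY mulr_suml; apply: ler_sum => j _.
  have yj : 0 <= Y^-1 * y t j by rewrite mulr_ge0 ?invr_ge0 ?ltW.
  by rewrite normrZ ger0_norm// ler_wpM2l// le_diameter.
pose s t := theta t / Y.
have s0 t : 0 <= s t by rewrite divr_ge0 // ltW.
(* Unit column sums cancel the mixing, leaving a subgradient step of effective size
   [theta t / Y]. *)
have uS t : u t.+1 = u t - s t *: \sum_i g t i.
  rewrite /u /s; under eq_bigr do rewrite w_rec.
  rewrite sumrB scalerBr; congr (_ - _); last first.
    by rewrite -scaler_sumr scalerA mulrC.
  congr (_ *: _); rewrite exchange_big/=; apply: eq_bigr => j _.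
  by rewrite -scaler_suml (A_stoch t).2 scale1r.
pose b t := 4 * (N%:R * L) * s t * D t + (N%:R * L) ^+ 2 * s t ^+ 2.
have step x t : dotv (u t.+1 - x) (u t.+1 - x) <=
    dotv (u t - x) (u t - x) - 2 * s t * (F (u t) - F x) + b t.
  rewrite uS; exact: subgradient_step (g_sub t) (gL t) fLip (zu t) L0 (s0 t).
have b0 t : 0 <= b t.
  rewrite addr_ge0//; last by rewrite mulr_ge0 ?sqr_ge0.
  by do 4!apply: mulr_ge0 => //.
have s2 : bounded_sums (fun t => s t ^+ 2).
  under [X in bounded_sums X]eq_fun do rewrite /s exprMn mulrC.
  by apply: bounded_sumsZ => //; exact: sqr_ge0.
have bb : bounded_sums b.
  apply: bounded_sumsD; last by apply: bounded_sumsZ => //; exact: sqr_ge0.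
  under [X in bounded_sums X]eq_fun do rewrite -mulrA.
  apply: bounded_sumsZ; last exact: bounded_sumsM.
  by rewrite !mulr_ge0.
have fejer x : minimizer F x ->
    cvgn (fun t => dotv (u t - x) (u t - x)) /\
    bounded_sums (fun t => 2 * s t * (F (u t) - F x)).
  move=> xP; apply: quasi_fejer (step x) bb => // t; first exact: dotv_ge0.
  by rewrite mulr_ge0 ?subr_ge0// mulr_ge0.
have FLip v v' : F v - F v' <= N%:R * L * `|v - v'|.
  rewrite -sumrB; apply: (@le_trans _ _ (\sum_(i < N) L * `|v - v'|)).
    exact: ler_sum.
  by rewrite sumr_const card_ord -[(L * _) *+ N]mulr_natl mulrA.
have liminf (e : R) : 0 < e -> forall n,
    exists2 m, (n <= m)%N & F (u m) < F xmin + e.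
  (* If the gap stayed at least [e] from [n] on, the summable Fejer decrements would dominate a
     multiple of [theta], making [theta] summable. *)
  move=> e0 n; apply: contrapT => /forall2NP Fe; apply: thetaoo.
  apply: (@bounded_sums_unshift _ n) => //.
  have [_ Fu] := fejer _ xminP.
  have Fu0 t : 0 <= 2 * s t * (F (u t) - F xmin).
    by rewrite mulr_ge0 ?subr_ge0// mulr_ge0.
  (* This factor undoes [2 / Y] in the decrement and leaves [theta] times the gap divided by [e]. *)
  have Ye : 0 <= Y / (2 * e) by rewrite divr_ge0 ?mulr_ge0 ?ltW.
  apply: bounded_sums_le (bounded_sumsZ Ye (bounded_sums_shift n Fu0 Fu)) => t.
  have [|/negP] := Fe (t + n)%N; first by rewrite leq_addl.
  rewrite -leNgt => Fge; set q := F (u _) - _.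
  have -> : Y / (2 * e) * (2 * s (t + n)%N * q) = theta (t + n)%N * (q / e).
    by rewrite /s; field; rewrite !gt_eqF.
  by rewrite ler_peMr// ler_pdivlMr// mul1r /q lerBrDl.
have [x [xP ux]] := opial_cvg (mulr_ge0 (ler0n _ _) L0) FLip xminP
  (fun x xP => (fejer x xP).1) liminf.
exists x; split=> // i; apply/cvgrPdist_lt => /= e e0.
have e2 : 0 < (e / 2) ^+ 2 by rewrite exprn_gt0// divr_gt0.
have e20 : 0 < e / 2 by rewrite divr_gt0.
have Dcvg := bounded_sums_cvg0 (fun t => sqr_ge0 (D t)) D2.
near=> t.
have h1 : `|x - u t| < e / 2.
  by near: t; move/cvgrPdist_lt : ux; exact.
have h2 : D t < e / 2.
  (* Only the squares of [D] are known to be summable, so smallness is compared after squaring. *)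
  rewrite -(@ltr_pXn2r _ 2)// ?nnegrE ?(ltW e20)//.
  near: t; exact: (cvgr_lt _ Dcvg).
have -> : x - z t i = (x - u t) + (u t - z t i) by rewrite addrA subrK.
apply: le_lt_trans (ler_normD _ _) _.
have := zu t i; rewrite distrC; lra.
Unshelve. all: by end_near.
Qed.
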